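(* Let $(S,\cdot,\le)$ be an ordered semigroup without zero element. The following conditions are equivalent: (1) $S$ is completely regular; (2) each $\mathcal{H}$-class of $S$ is a group like ordered semigroup; (3) $S$ is a union of group like ordered semigroups (i.e. $S$ is a union of subsemigroups each of which is a group like ordered semigroup).
   Context: An ordered semigroup $(S,\cdot,\le)$ is a semigroup $(S,\cdot)$ that is a poset $(S,\le)$ such that $a\le b$ implies $ca\le cb$ and $ac\le bc$ for all $a,b,c\in S$. A zero element is an element $0$ with $0x=x0=0$ and $0\le x$ for all $x\in S$. For $H\subseteq S$, $(H]=\{t\in S: t\le h \text{ for some } h\in H\}$. $S$ is completely regular if $a\in(a^2Sa^2]$ for every $a\in S$. A nonempty $I\subseteq S$ is a left (right) ideal if $SI\subseteq I$ ($IS\subseteq I$) and $(I]\subseteq I$; $L(a)$ and $R(a)$ denote the smallest left and right ideals containing $a$. Green's relations: $a\,\mathcal{L}\,b$ iff $L(a)=L(b)$; $a\,\mathcal{R}\,b$ iff $R(a)=R(b)$; $\mathcal{H}=\mathcal{L}\cap\mathcal{R}$. An ordered semigroup $T$ is group like if for all $a,b\in T$ there are $x,y\in T$ such that $a\le xb$ and $a\le by$. Subsemigroups of $S$ carry the induced order. *)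

(* Defs.v *)
From HB Require Import structures.
From mathcomp Require Import all_boot all_order.
From mathcomp Require Import boolp classical_sets.

Set Implicit Arguments.
Unset Strict Implicit.
Unset Printing Implicit Defensive.

Local Open Scope classical_set_scope.
Local Open Scope order_scope.
Local Open Scope group_scope.

(* The order and equality are boolean, as everywhere in MathComp; the axioms of
   boolp make every Type a choiceType and every proposition a boolean, so this
   loses no generality. *)
HB.mixin Record isOrderedSemigroup d S of Order.POrder d S & Semigroup S := {
  mul_lel : forall c a b : S, a <= b -> c * a <= c * b;
  mul_ler : forall c a b : S, a <= b -> a * c <= b * c
}.

#[short(type="orderedSemigroupType")]
HB.structure Definition OrderedSemigroup d :=
  { S of isOrderedSemigroup d S & Order.POrder d S & Semigroup S }.

Section OrderedSemigroup.
Context {d : Order.disp_t} {S : orderedSemigroupType d}.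
Implicit Types (a b x y z : S) (A H I T : set S).

Definition is_zero z := forall x, [/\ z * x = z, x * z = z & z <= x].

Definition downset H : set S := [set t | exists2 h, H h & t <= h].

Definition completely_regular_at a :=
  downset [set (a * a) * s * (a * a) | s in [set: S]] a.

Definition left_ideal I :=
  [/\ I !=set0, forall s x, I x -> I (s * x) & downset I `<=` I].

Definition right_ideal I :=
  [/\ I !=set0, forall s x, I x -> I (x * s) & downset I `<=` I].

Definition Lideal a : set S := smallest left_ideal [set a].
Definition Rideal a : set S := smallest right_ideal [set a].

Definition greenL a b := Lideal a = Lideal b.
Definition greenR a b := Rideal a = Rideal b.
Definition greenH a b := greenL a b /\ greenR a b.

Definition Hclass a : set S := [set b | greenH a b].

Definition subsemigroup T :=
  T !=set0 /\ forall a b, T a -> T b -> T (a * b).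

(* T is an ordered semigroup in its own right, for the operation and order
   induced by S; accordingly the witnesses x and y are taken in T. *)
Definition group_like T :=
  subsemigroup T /\
  forall a b, T a -> T b ->
    exists x y, [/\ T x, T y, a <= x * b & a <= b * y].

End OrderedSemigroup.

Definition completely_regular d (S : orderedSemigroupType d) :=
  forall a : S, completely_regular_at a.

Definition union_of_group_like d (S : orderedSemigroupType d) :=
  exists F : set (set S),
    (forall T, F T -> group_like T) /\ \bigcup_(T in F) T = [set: S].

(* Main.v *)
Require Import Defs.
From mathcomp Require Import all_boot all_order.
From mathcomp Require Import boolp classical_sets.

(** The equivalence goes round the cycle (1) => (2) => (3) => (1).

    (3) => (1): if [a] lies in a group like [T], then so does [a * a], hence
    [a <= x * (a * a)] and [x <= (a * a) * y] for some [x] and [y].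
    (2) => (3): every element belongs to its own H-class.

    (1) => (2) is the substantial part.  Complete regularity makes the principal
    ideals simple, [L(b) = (Sb]] and [R(b) = (bS]], so that L and R are the
    equivalences of the preorders [exists s, a <= s * b] and
    [exists s, a <= b * s].  Since [c <= c^2 s c^2], each [c] is L- and R-related
    to its square, and the one-sided compatibility of L and R makes an H-class
    closed under products.

    For group likeness, let [a] and [b] be H-related and [a <= s * b].  The
    factor [s] has to be replaced by one in the H-class.  In an ordinary
    completely regular semigroup one would multiply [s] on both sides by the
    identity of the H-class; here there is no identity, and the obvious
    substitutes such as [b^2 u b] need not even lie in the H-class.  What is left
    is an element [v] which bounds [b] as a group inverse would (lemma
    [pseudo_inverse]): [b <= b v b], [v <= v v b] and [v <= b v v].  From these
    inequalities [x := b v v b] serves as an identity, in that [b <= x b] and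
    [b <= b x], and moreover [b] can be recovered from [x] on each side:
    [b <= (b v b) x] and [b <= x (b v b)].  With [v] attached to [a] and [x] to
    [b], the factor [p := a v s x] then satisfies [a <= p b] and is H-related
    to [a] (lemma [Hclass_left_factor]). *)

Set Implicit Arguments.
Unset Strict Implicit.
Unset Printing Implicit Defensive.

Import Order.POrderTheory.

Local Open Scope classical_set_scope.
Local Open Scope order_scope.
Local Open Scope group_scope.

(** * Pseudo-inverses *)

Section PseudoInverse.
Context {d : Order.disp_t} {S : orderedSemigroupType d}.
Implicit Types (b u v : S).

(** Given [b <= b^2 u b^2], the element [v := b u b] works: the first bound is the
    hypothesis rebracketed, and the other two come from applying the hypothesis
    to the last, respectively the first, letter of [b u b]. *)
Lemma pseudo_inverse b : completely_regular_at b ->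
  exists v, [/\ b <= b * v * b, v <= v * v * b & v <= b * v * v].
Proof.
move=> [_ [u _ <-] le_b]; exists (b * u * b); split.
- by move: le_b; rewrite !mulgA.
- by have := mul_lel (b * u) _ _ le_b; rewrite !mulgA.
- by have := mul_ler (u * b) _ _ le_b; rewrite !mulgA.
Qed.

(** The element [b v v b] acts on [b] as an identity would, from either side,
    and bounds [b] after a suitable multiplication from either side. *)
Section PseudoIdentity.
Variables b v : S.
Hypotheses (le_b : b <= b * v * b).
Hypotheses (le_vr : v <= v * v * b) (le_vl : v <= b * v * v).

Lemma pseudo_identity_mull : b <= b * v * v * b * b.
Proof.
apply: (le_trans le_b).
by have := mul_ler b _ _ (mul_lel b _ _ le_vr); rewrite !mulgA.
Qed.

Lemma pseudo_identity_mulr : b <= b * (b * v * v * b).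
Proof.
apply: (le_trans le_b).
by have := mul_ler b _ _ (mul_lel b _ _ le_vl); rewrite !mulgA.
Qed.

Lemma le_mul_pseudo_identity : b <= b * v * b * (b * v * v * b).
Proof.
apply: (le_trans le_b); rewrite -[X in _ <= X]mulgA.
by apply: mul_lel; apply: pseudo_identity_mulr.
Qed.

Lemma le_pseudo_identity_mul : b <= b * v * v * b * (b * v * b).
Proof.
apply: (le_trans le_b).
by have := mul_ler (v * b) _ _ pseudo_identity_mull; rewrite !mulgA.
Qed.

End PseudoIdentity.
End PseudoInverse.

(** * Green's relations in a completely regular ordered semigroup *)

Section Green.
Context {d : Order.disp_t} {S : orderedSemigroupType d}.
Hypothesis crS : completely_regular S.
Implicit Types (a b c s t x y : S).

Lemma le_mul_sqr a : exists s, a <= s * (a * a).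
Proof. by have [_ [s _ <-] le_a] := crS a; exists (a * a * s). Qed.

Lemma le_sqr_mul a : exists s, a <= a * a * s.
Proof.
have [_ [s _ <-] le_a] := crS a; exists (s * (a * a)).
by rewrite mulgA.
Qed.

(** [(Sb]] is a left ideal, and it contains [b] by complete regularity; any left
    ideal containing [b] contains [(Sb]]. *)
Lemma LidealE b : Lideal b = [set a | exists s, a <= s * b].
Proof.
apply/seteqP; split=> [a La|a [s le_a] I [[_ mulI downI] bI]].
- apply: La; split; last first.
    by move=> _ ->; have [s le_b] := le_mul_sqr b; exists (s * b); rewrite -mulgA.
  split.
  + by exists (b * b); exists b.
  + by move=> s x [t le_x]; exists (s * t); rewrite -mulgA; apply: mul_lel.
  + by move=> x [y [t le_y] le_x]; exists t; apply: le_trans le_y.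
- by apply: downI; exists (s * b) => //; apply: mulI; apply: bI.
Qed.

Lemma RidealE b : Rideal b = [set a | exists s, a <= b * s].
Proof.
apply/seteqP; split=> [a Ra|a [s le_a] I [[_ mulI downI] bI]].
- apply: Ra; split; last first.
    by move=> _ ->; have [s le_b] := le_sqr_mul b; exists (b * s); rewrite mulgA.
  split.
  + by exists (b * b); exists b.
  + by move=> s x [t le_x]; exists (t * s); rewrite mulgA; apply: mul_ler.
  + by move=> x [y [t le_y] le_x]; exists t; apply: le_trans le_y.
- by apply: downI; exists (b * s) => //; apply: mulI; apply: bI.
Qed.

Lemma greenLP a b :
  greenL a b <-> (exists s, a <= s * b) /\ (exists s, b <= s * a).
Proof.
rewrite /greenL !LidealE; split=> [eqL|[[s le_a] [t le_b]]].
- have sqr_le c : exists s, c <= s * c.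
    by have [s le_c] := le_mul_sqr c; exists (s * c); rewrite -mulgA.
  split.
  + by suff: [set x | exists s, x <= s * b] a by []; rewrite -eqL; apply: sqr_le.
  + by suff: [set x | exists s, x <= s * a] b by []; rewrite eqL; apply: sqr_le.
- apply/seteqP; split=> c [r le_c].
  + by exists (r * s); apply: (le_trans le_c); rewrite -mulgA; apply: mul_lel.
  + by exists (r * t); apply: (le_trans le_c); rewrite -mulgA; apply: mul_lel.
Qed.

Lemma greenRP a b :
  greenR a b <-> (exists s, a <= b * s) /\ (exists s, b <= a * s).
Proof.
rewrite /greenR !RidealE; split=> [eqR|[[s le_a] [t le_b]]].
- have sqr_le c : exists s, c <= c * s.
    by have [s le_c] := le_sqr_mul c; exists (c * s); rewrite mulgA.
  split.
  + by suff: [set x | exists s, x <= b * s] a by []; rewrite -eqR; apply: sqr_le.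
  + by suff: [set x | exists s, x <= a * s] b by []; rewrite eqR; apply: sqr_le.
- apply/seteqP; split=> c [r le_c].
  + by exists (s * r); apply: (le_trans le_c); rewrite mulgA; apply: mul_ler.
  + by exists (t * r); apply: (le_trans le_c); rewrite mulgA; apply: mul_ler.
Qed.

Lemma greenH_sym a b : greenH a b -> greenH b a.
Proof. by case. Qed.

Lemma greenH_trans b a c : greenH a b -> greenH b c -> greenH a c.
Proof.
by move=> [Lab Rab] [Lbc Rbc]; split; [apply: etrans Lbc | apply: etrans Rbc].
Qed.

(** [a * b] is L-related to [b * b], hence to [b], and R-related to [a * a],
    hence to [a]. *)
Lemma greenH_mul a b : greenH a b -> greenH a (a * b).
Proof.
move=> [Lab Rab]; split.
- rewrite /greenL Lab; apply/greenLP; split; last by exists a.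
  have [s le_b] := le_mul_sqr b; have /greenLP[_ [t le_ba]] := Lab.
  exists (s * t); apply: (le_trans le_b); rewrite -mulgA; apply: mul_lel.
  by rewrite mulgA; apply: mul_ler.
- apply/greenRP; split; last by exists b.
  have [s le_a] := le_sqr_mul a; have /greenRP[[t le_ab] _] := Rab.
  exists (t * s); apply: (le_trans le_a); rewrite mulgA; apply: mul_ler.
  by rewrite -mulgA; apply: mul_lel.
Qed.

(** * Group likeness of the H-classes *)

(** With [a <= s * b], [v] a pseudo-inverse of [a], [w] one of [b] and
    [x := b w w b], the factor is [p := a v s x].  It is R-related to [a] because
    it starts with [a] and [a <= p b].  It ends with [b]; conversely
    [a w w b <= p] because [a <= a v a <= a v s b], and [b <= r * a] turns
    [b <= (b w b) x] into [b <= (b w b) r p]. *)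
Lemma Hclass_left_factor a b : greenH a b ->
  exists2 p, greenH a p & a <= p * b.
Proof.
move=> [Lab Rab].
have /greenLP[[s le_asb] [r le_bra]] := Lab.
have [v [le_a _ _]] := pseudo_inverse (crS a).
have [w [le_b le_wr le_wl]] := pseudo_inverse (crS b).
have le_avsb : a <= a * v * s * b.
  by apply: (le_trans le_a); rewrite -[X in _ <= X]mulgA; apply: mul_lel.
set x := b * w * w * b; set p := a * v * s * x.
have le_apb : a <= p * b.
  apply: (le_trans le_avsb); rewrite -[X in _ <= X]mulgA; apply: mul_lel.
  exact: pseudo_identity_mull.
exists p => //; split.
- rewrite /greenL Lab; apply/greenLP; split.
  + exists (b * w * b * r).
    apply: (le_trans (le_mul_pseudo_identity le_b le_wl)).
    rewrite -[X in _ <= X]mulgA; apply: mul_lel.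
    have : b * (w * w * b) <= r * (a * v * s * b) * (w * w * b).
      apply: mul_ler; apply: (le_trans le_bra); exact: mul_lel.
    by rewrite /p /x !mulgA.
  + by exists (a * v * s * (b * w * w)); rewrite /p /x !mulgA.
- apply/greenRP; split; first by exists b.
  by exists (v * s * x); rewrite /p !mulgA.
Qed.

Lemma Hclass_right_factor a b : greenH a b ->
  exists2 q, greenH a q & a <= b * q.
Proof.
move=> [Lab Rab].
have /greenRP[[s le_abs] [r le_bar]] := Rab.
have [v [le_a _ _]] := pseudo_inverse (crS a).
have [w [le_b le_wr le_wl]] := pseudo_inverse (crS b).
have le_absv : a <= b * (s * v * a).
  by apply: (le_trans le_a); rewrite !mulgA; apply: mul_ler; apply: mul_ler.
set x := b * w * w * b; set q := x * (s * v * a).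
have le_abq : a <= b * q.
  apply: (le_trans le_absv); rewrite /q [X in _ <= X]mulgA; apply: mul_ler.
  exact: pseudo_identity_mulr.
exists q => //; split.
- apply/greenLP; split; first by exists b.
  by exists (x * s * v); rewrite /q !mulgA.
- rewrite /greenR Rab; apply/greenRP; split.
  + exists (r * (b * w * b)).
    apply: (le_trans (le_pseudo_identity_mul le_b le_wr)).
    rewrite [X in _ <= X]mulgA; apply: mul_ler.
    have : b * w * w * b <= b * w * w * (b * (s * v * a) * r).
      apply: mul_lel; apply: (le_trans le_bar); exact: mul_ler.
    by rewrite /q /x !mulgA.
  + by exists (w * w * b * (s * v * a)); rewrite /q /x !mulgA.
Qed.

Lemma Hclass_group_like a : group_like (Hclass a).
Proof.
split; first split.
- by exists a.
- move=> b c Hab Hac; apply: (greenH_trans Hab); apply: greenH_mul.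
  exact: greenH_trans (greenH_sym Hab) Hac.
- move=> b c Hab Hac.
  have Hbc : greenH b c := greenH_trans (greenH_sym Hab) Hac.
  have [p Hbp le_p] := Hclass_left_factor Hbc.
  have [q Hbq le_q] := Hclass_right_factor Hbc.
  by exists p, q; split=> //; apply: greenH_trans Hab _.
Qed.

End Green.

Lemma group_like_completely_regular_at d (S : orderedSemigroupType d)
  (T : set S) (a : S) : group_like T -> T a -> completely_regular_at a.
Proof.
move=> [[_ mulT] divT] Ta; have Taa := mulT _ _ Ta Ta.
have [x [_ [Tx _ le_a _]]] := divT _ _ Ta Taa.
have [_ [y [_ _ _ le_x]]] := divT _ _ Tx Taa.
exists (a * a * y * (a * a)); first by exists y.
by apply: (le_trans le_a); apply: mul_ler.
Qed.

Theorem theorem4p8 (d : Order.disp_t) (S : orderedSemigroupType d)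
    (no_zero : ~ exists z : S, is_zero z) :
  [<-> completely_regular S;
       forall a : S, group_like (Hclass a);
       union_of_group_like S].
Proof.
tfae.
- exact: Hclass_group_like.
- move=> glH; exists (range (@Hclass d S)); split; first by move=> _ [a _ <-].
  by apply/seteqP; split=> // a _; exists (Hclass a) => //; exists a.
- move=> [F [glF coverF]] a.
  have : (\bigcup_(T in F) T) a by rewrite coverF.
  by move=> [T FT Ta]; apply: group_like_completely_regular_at (glF _ FT) Ta.
Qed.
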